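(* Let $K$ be a real quadratic field with ring of integers $\mathbb O$, and let $A=\begin{bmatrix}a&b\\c&d\end{bmatrix}\in\mathrm{PSL}_2^\pm\mathbb O$ be positive. With $f,t,E^\sharp,E^\natural,E^\flat$ associated to $A$ as in the context, the following statements hold. 1. $f$ is nondecreasing on $[0,1]$ and nonincreasing on $[1,\infty]$. 2. $E^\sharp$ is either empty, or an open interval containing $1$. 3. Either $E^\natural$ contains at most two points, or it equals one of the intervals $[0,1]$, $[1,\infty]$. 4. $H(A*\beta)>H(\beta)$ for every $\beta\in E^\sharp\cap K$; the same holds if $A$ is strictly positive and $\beta\in K$ is a boundary point of $E^\sharp$ such that $A*\beta\ne1$. 5. If $E^\natural$ is an interval, then $\{\beta\in E^\natural\cap K:H(A*\beta)=H(\beta)\}$ is dense in $E^\natural$. 6. $\{\beta\in E^\flat\cap K:H(A*\beta)<H(\beta)\}$ is dense in $E^\flat$.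
   Context: $\mathrm{PSL}_2^\pm\mathbb O$ is the group of $2\times2$ matrices over $\mathbb O$ with determinant $+1$ or $-1$, modulo $\pm1$, acting on $\mathrm P^1\mathbb R$ by $A*x=\frac{ax+b}{cx+d}$. The matrix $A$ is positive if, up to multiplication by $-1$, all its entries are $\ge0$ with at most one entry equal to $0$; it is strictly positive if (up to sign) all entries are $>0$. Positive matrices are written with entries $\ge0$. Let $'$ denote the nontrivial automorphism of $K$ and $\lor$ the maximum. Define, for $x\in[0,\infty]\subset\mathrm P^1\mathbb R$, $$f(x)=\frac{(ax+b)\lor(cx+d)}{x\lor1}\quad(f(\infty)=a\lor c),\qquad t=(|a'|+|c'|)\lor(|b'|+|d'|),$$ $$E^\sharp=\{x\in[0,\infty]:f(x)>t\},\quad E^\natural=\{x\in[0,\infty]:f(x)=t\},\quad E^\flat=\{x\in[0,\infty]:f(x)<t\}.$$ Topological notions (open, boundary, dense) are relative to the space $[0,\infty]$; in (3) and (5), ''interval'' means interval of positive length. $H$ is the absolute Weil height: for $\alpha=[\alpha_1,\alpha_2]\in\mathrm P^1K$, $H(\alpha)=\prod_P\max(|\alpha_1|_P,|\alpha_2|_P)$ over all places $P$ of $K$, with $|x|_P=|\sigma(x)|^{1/2}$ for the archimedean place of the embedding $\sigma:K\to\mathbb R$, and $|p|_P=p^{-[K_P:\mathbb Q_p]/2}$ for $P$ lying over the rational prime $p$. *)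

(* Defs.v *)
From HB Require Import structures.
From mathcomp Require Import all_boot all_order all_algebra all_field.
From mathcomp Require Import all_classical all_reals all_analysis.
Import Order.TTheory GRing.Theory Num.Theory.
Import numFieldNormedType.Exports.

Set Implicit Arguments.
Unset Strict Implicit.
Unset Printing Implicit Defensive.

Local Open Scope classical_set_scope.
Local Open Scope ring_scope.

Section AbsoluteValues.
Variable R : realType.

Definition absolute_value (F : fieldType) (v : F -> R) : Prop :=
  [/\ forall x, 0 <= v x,
      forall x, v x = 0 <-> x = 0,
      forall x y, v (x * y) = v x * v y
    & forall x y, v (x + y) <= v x + v y].

Definition ultrametric (F : fieldType) (v : F -> R) : Prop :=
  forall x y, v (x + y) <= Num.max (v x) (v y).

Definition complete_for (F : fieldType) (v : F -> R) : Prop :=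
  forall u : nat -> F,
    (forall e : R, 0 < e -> exists N, forall m n,
       (N <= m)%N -> (N <= n)%N -> v (u m - u n) < e) ->
    exists l, forall e : R, 0 < e ->
      exists N, forall n, (N <= n)%N -> v (u n - l) < e.

(* (L, w) is the completion of (F, v), through the embedding i *)
Definition is_completion (F L : fieldType) (v : F -> R) (w : L -> R)
    (i : {rmorphism F -> L}) : Prop :=
  [/\ absolute_value w,
      forall x, w (i x) = v x,
      forall (z : L) (e : R), 0 < e -> exists x, w (z - i x) < e
    & complete_for w].

(* n = [K_v : Q_p]: Qp and Kv are the completions of the rationals and of K
   for v, and Qp is a subfield of Kv, with compatible absolute values. No
   compatibility of i0 and i is required, since there is only one ring
   morphism from rat to Kv. *)
Definition local_degree (K : fieldExtType rat) (v : K -> R) (n : nat) : Prop :=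
  exists (Qp : fieldType) (w0 : Qp -> R) (i0 : {rmorphism rat -> Qp})
         (Kv : fieldExtType Qp) (w : Kv -> R) (i : {rmorphism K -> Kv}),
  [/\ is_completion (fun q : rat => v q%:A) w0 i0,
      is_completion v w i,
      forall q : Qp, w q%:A = w0 q
    & \dim {:Kv} = n].

(* Places of a quadratic field K are represented by their normalized absolute
   values, whose exponents 1/2 and n/2 include the division by [K : Q]. *)
Definition archimedean_place (K : fieldExtType rat) : set (K -> R) :=
  [set v | exists s : {rmorphism K -> R}, v = fun x => `|s x| `^ (1 / 2)].

Definition finite_place (K : fieldExtType rat) : set (K -> R) :=
  [set v | [/\ absolute_value v, ultrametric v
    & exists p n : nat, [/\ prime p, local_degree v n
        & v p%:R = p%:R `^ (- (n%:R / 2))]]].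

(* Points of the projective line over K are given by homogeneous coordinates,
   as nonzero column vectors up to scaling, on which matrices act by
   multiplication. *)
Definition affine_pt (K : fieldType) (b : K) : 'cV[K]_2 :=
  \col_(i < 2) (if i == 0 then b else 1).

Definition same_point (K : fieldType) (x y : 'cV[K]_2) : Prop :=
  exists2 k : K, k != 0 & x = k *: y.

(* At each nonzero vector only finitely many finite places contribute a factor
   different from 1, so the second (finitely supported) product is the full
   one. Scaling x does not change the value, by the product formula. *)
Definition height (K : fieldExtType rat) (x : 'cV[K]_2) : R :=
  (\big[*%R/1]_(v \in @archimedean_place K) Num.max (v (x 0 0)) (v (x 1 0))) *
  (\big[*%R/1]_(v \in @finite_place K) Num.max (v (x 0 0)) (v (x 1 0))).

End AbsoluteValues.

Section Matrices.
Variables (R : realType) (K : fieldExtType rat) (s : {rmorphism K -> R}).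

Definition is_integer (x : K) : Prop :=
  integralOver (intr : int -> K) x.

(* A represents an element of PSL_2^\pm of the ring of integers of K *)
Definition PSL2pm (A : 'M[K]_2) : Prop :=
  (forall i j, is_integer (A i j)) /\ (\det A = 1 \/ \det A = -1).

Definition nonneg_entries (A : 'M[K]_2) : Prop := forall i j, 0 <= s (A i j).

Definition positive_mx (A : 'M[K]_2) : Prop :=
  exists2 B, B = A \/ B = - A
    & nonneg_entries B /\
      (#|[pred ij : 'I_2 * 'I_2 | B ij.1 ij.2 == 0%R]| <= 1)%N.

Definition strictly_positive_mx (A : 'M[K]_2) : Prop :=
  exists2 B, B = A \/ B = - A & forall i j, 0 < s (B i j).

End Matrices.

Section Intervals.
Variable R : realType.

(* The interval [0, oo] of the real projective line is identified with the
   interval of nonnegative extended reals. *)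
Definition pospart : set (\bar R) := [set x | (0%:E <= x)%E].

Definition rel_open (E : set (\bar R)) : Prop :=
  open (E : set (subspace pospart)).

Definition rel_boundary (E : set (\bar R)) : set (\bar R) :=
  closure (E : set (subspace pospart)) `&`
  closure (pospart `\` E : set (subspace pospart)).

Definition rel_dense (D E : set (\bar R)) : Prop :=
  D `<=` E /\ E `<=` closure (D : set (subspace pospart)).

Definition interval_set (E : set (\bar R)) : Prop :=
  exists i : interval (\bar R), E = [set` i].

Definition proper_interval (E : set (\bar R)) : Prop :=
  interval_set E /\ exists x y, [/\ E x, E y & (x < y)%E].

End Intervals.

(* A is meant to be the representative with nonnegative entries; s embeds K in
   the reals and tau is the nontrivial automorphism of K. *)
Section Partition.
Variables (R : realType) (K : fieldExtType rat) (s : {rmorphism K -> R}).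
Variables (tau : {rmorphism K -> K}) (A : 'M[K]_2).

(* The value at -oo is irrelevant. *)
Definition stretch (x : \bar R) : R :=
  let a := s (A 0 0) in let b := s (A 0 1) in
  let c := s (A 1 0) in let d := s (A 1 1) in
  match x with
  | r%:E => Num.max (a * r + b) (c * r + d) / Num.max r 1
  | +oo%E => Num.max a c
  | -oo%E => 0
  end.

Definition threshold : R :=
  let a' := s (tau (A 0 0)) in let b' := s (tau (A 0 1)) in
  let c' := s (tau (A 1 0)) in let d' := s (tau (A 1 1)) in
  Num.max (`|a'| + `|c'|) (`|b'| + `|d'|).

Definition Esharp : set (\bar R) :=
  [set x | pospart x /\ threshold < stretch x].
Definition Enatural : set (\bar R) :=
  [set x | pospart x /\ stretch x = threshold].
Definition Eflat : set (\bar R) :=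
  [set x | pospart x /\ stretch x < threshold].

End Partition.

(* Main.v *)
Require Import Defs.
From HB Require Import structures.
From mathcomp Require Import all_boot all_order all_algebra all_field.
From mathcomp Require Import all_classical all_reals all_analysis.
From mathcomp Require Import ring lra.
Import Order.TTheory GRing.Theory Num.Theory.
Import numFieldNormedType.Exports.

Set Implicit Arguments.
Unset Strict Implicit.
Unset Printing Implicit Defensive.

Local Open Scope classical_set_scope.
Local Open Scope ring_scope.

(* The factors of the height at the finite places are invariant under matrices
   with integral entries and determinant 1 or -1, so that
   (H(A * beta) / H(beta))^2 = f(beta) g(beta'), where beta' is the conjugate of
   beta and g(y) = max(|a'y + b'|, |c'y + d'|) / max(|y|, 1). Since t is the
   operator norm, for the maximum norm, of the inverse of the conjugate matrix
   A', the minimum of g on the projective line is 1 / t. Hence the height grows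
   where f > t, and, the pairs (beta, beta') being dense in the plane, it
   decreases on a dense set of points where f < t.
   On [0, 1], f is the maximum of ax + b and cx + d; if it equals t on a segment,
   then one of a, c vanishes, say a = 0, t = b and c = 1 / b. The integer b - d
   must have a norm at least 1 in absolute value, which forces c + d <= b, so
   that f = b on the whole of [0, 1]; moreover g = 1 / t near -d'/c'. *)

(** * Quadratic fields *)

Lemma rmorph_alg (K : fieldExtType rat) (tau : {rmorphism K -> K}) (q : rat) :
  tau q%:A = q%:A.
Proof. by rewrite alg_num_field fmorph_rat. Qed.

(** An x moved by [tau] is not rational, so 1 and x span K, and x^2 = p + q x. Since [tau x] is the
    other root of this equation, [tau x] = q - x, and y = 2x - q is negated. *)
Lemma quadratic_generator (K : fieldExtType rat) (hK : \dim {:K} = 2%N)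
    (tau : {rmorphism K -> K}) (htau : exists x, tau x <> x) :
  exists y : K, [/\ tau y = - y, y != 0, (exists q : rat, y ^+ 2 = q%:A)
    & forall z : K, exists p q : rat, z = p%:A + q%:A * y].
Proof.
have tauQ := rmorph_alg tau.
have [x tx] := htau.
have span_of (w : K) : tau w <> w -> forall z, exists p q : rat, z = p%:A + q%:A * w.
  move=> tw.
  have xQ : w \notin <[1 : K]>%VS.
    by apply/vlineP => -[k wk]; apply: tw; rewrite wk tauQ.
  have dim2 : \dim (<[1 : K]> + <[w]>) = 2%N.
    rewrite dimv_disjoint_sum; first by rewrite !dim_vline oner_neq0;
      case: eqP xQ => // ->; rewrite mem0v.
    apply/eqP; rewrite -subv0; apply/subvP => z /memv_capP[/vlineP[p ->] /vlineP[q e]].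
    rewrite memv0; have [q0|q0] := eqVneq q 0; first by rewrite e q0 scale0r.
    case/negP: xQ; apply/vlineP; exists (q^-1 * p).
    by rewrite -scalerA e scalerA mulVf// scale1r.
  have full : (<[1 : K]> + <[w]>)%VS = {:K}%VS.
    by apply/eqP; rewrite eqEdim subvf dim2 hK.
  move=> z; have : z \in (<[1 : K]> + <[w]>)%VS by rewrite full memvf.
  move=> /memv_addP[_ /vlineP[p ->] [_ /vlineP[q ->] ->]].
  by exists p, q; rewrite mulr_algl.
have [p [q x2]] := span_of x tx (x ^+ 2).
have txE : tau x = q%:A - x.
  have e : (tau x - x) * (tau x + x - q%:A) = 0.
    have : tau (x ^+ 2) = p%:A + q%:A * tau x by rewrite x2 rmorphD rmorphM !tauQ.
    rewrite rmorphXn => e.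
    have -> : (tau x - x) * (tau x + x - q%:A)
      = tau x ^+ 2 - q%:A * tau x - (x ^+ 2 - q%:A * x) by ring.
    by rewrite e x2; ring.
  move/eqP: e; rewrite mulf_eq0 => /orP[/eqP e|/eqP e].
    by case: tx; apply/eqP; rewrite -subr_eq0 e.
  by apply/eqP; rewrite -subr_eq0 -e; apply/eqP; ring.
have ty : tau (x *+ 2 - q%:A) = - (x *+ 2 - q%:A).
  by rewrite rmorphB rmorphMn tauQ txE; ring.
have y0 : x *+ 2 - q%:A != 0.
  apply/eqP => e; apply: tx; rewrite txE.
  have -> : q%:A - x = x - (x *+ 2 - q%:A) by ring.
  by rewrite e subr0.
exists (x *+ 2 - q%:A); split => //.
  exists (p *+ 4 + q ^+ 2).
  have -> : (p *+ 4 + q ^+ 2)%:A = p%:A *+ 4 + q%:A ^+ 2 :> K.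
    by rewrite -!in_algE rmorphD rmorphMn rmorphXn.
  have -> : (x *+ 2 - q%:A) ^+ 2 = (x ^+ 2) *+ 4 - (q%:A * x) *+ 4 + q%:A ^+ 2.
    by ring.
  by rewrite x2; ring.
apply: span_of; rewrite ty => e; move/eqP: y0; apply.
have : (x *+ 2 - q%:A) *+ 2 = 0 by rewrite mulr2n -{1}e addNr.
move/eqP; rewrite -mulr_natr mulf_eq0 => /orP[/eqP//|].
rewrite -(rmorph_nat (in_alg K)) /=.
by rewrite (fmorph_eq0 (in_alg K)).
Qed.

Lemma rmorph_alg_rat (K : fieldExtType rat) (F : numFieldType)
  (s : {rmorphism K -> F}) (q : rat) : s q%:A = ratr q.
Proof. by rewrite alg_num_field fmorph_rat. Qed.

(** With [tau y] = - y, the element a + c y has the two real images a + c [s y] and a - c [s y]. So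
    a and c [s y] need only approximate half the sum and half the difference of the midpoints of the
    two intervals. *)
Lemma weak_approximation (R : realType) (K : fieldExtType rat)
    (hK : \dim {:K} = 2%N) (s : {rmorphism K -> R})
    (tau : {rmorphism K -> K}) (htau : exists x, tau x <> x) (u v p q : R) :
  u < v -> p < q -> exists b : K, u < s b < v /\ p < s (tau b) < q.
Proof.
move=> uv pq; have [y [ty y0 _ _]] := quadratic_generator hK htau.
wlog sy0 : y ty y0 / 0 < s y => [wl|].
  have [|sy0|/eqP] := ltgtP 0 (s y); first exact: wl.
  - by apply: (wl (- y)); rewrite ?oppr_eq0 ?rmorphN ?ty//; lra.
  - by rewrite eq_sym fmorph_eq0 (negPf y0).
(* Two errors below e / 4 add up to less than e / 2, half the shorter interval. *)
pose e := Num.min (v - u) (q - p).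
have e0 : 0 < e by rewrite /e lt_min; apply/andP; split; lra.
have eu : e <= v - u by rewrite /e ge_min lexx.
have ep : e <= q - p by rewrite /e ge_min lexx orbT.
pose m1 := (u + v) / 2; pose m2 := (p + q) / 2.
have [|a /= /itvP ha] := @rat_in_itvoo R ((m1 + m2) / 2 - e / 4) ((m1 + m2) / 2 + e / 4).
  by lra.
have [|c /= /itvP hc] := @rat_in_itvoo R (((m1 - m2) / 2 - e / 4) / s y)
  (((m1 - m2) / 2 + e / 4) / s y).
  by rewrite ltr_pM2r ?invr_gt0//; lra.
have a1 : (m1 + m2) / 2 - e / 4 < ratr a by rewrite ha.
have a2 : ratr a < (m1 + m2) / 2 + e / 4 by rewrite ha.
have c1 : (m1 - m2) / 2 - e / 4 < ratr c * s y by rewrite -ltr_pdivrMr// hc.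
have c2 : ratr c * s y < (m1 - m2) / 2 + e / 4 by rewrite -ltr_pdivlMr// hc.
exists (a%:A + c%:A * y).
rewrite !rmorphD !rmorphM !rmorph_alg ty rmorphN !rmorph_alg_rat.
by rewrite /m1 /m2 in a1 a2 c1 c2; split; apply/andP; split; lra.
Qed.

(** A morphism r to the reals sends y to a square root of the rational y^2, hence to [s y] or
    [- s y], and so equals [s] or [s \o tau]. *)
Lemma archimedean_placeE (R : realType) (K : fieldExtType rat)
    (hK : \dim {:K} = 2%N) (s : {rmorphism K -> R})
    (tau : {rmorphism K -> K}) (htau : exists x, tau x <> x) :
  @archimedean_place R K = [set (fun x : K => `|s x| `^ (1 / 2))] `|`
    [set (fun x : K => `|s (tau x)| `^ (1 / 2))].
Proof.
have [y [ty y0 [D yD] gen]] := quadratic_generator hK htau.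
apply/seteqP; split => [v [r ->]|v [->|->]]; last 2 first.
- by exists s.
- by exists (s \o tau).
have e : (r y - s y) * (r y + s y) = 0.
  by rewrite -subr_sqr -!rmorphXn yD !rmorph_alg_rat subrr.
have rE z : exists p q : rat, r z = ratr p + ratr q * r y /\
    (s z = ratr p + ratr q * s y /\ s (tau z) = ratr p - ratr q * s y).
  have [p [q ->]] := gen z; exists p, q.
  by rewrite !rmorphD !rmorphM !rmorph_alg ty rmorphN !rmorph_alg_rat mulrN.
move/eqP: e; rewrite mulf_eq0 subr_eq0 addr_eq0 => /orP[/eqP e|/eqP e]; [left|right];
  apply/funext => z; have [p [q [-> [sz stz]]]] := rE z.
- by rewrite sz e.
- by rewrite stz e mulrN.
Qed.

(** Ensures that the product over the archimedean places has two factors; 1 + y separates them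
    because [s y] is nonzero. *)
Lemma archimedean_place_neq (R : realType) (K : fieldExtType rat)
    (hK : \dim {:K} = 2%N) (s : {rmorphism K -> R})
    (tau : {rmorphism K -> K}) (htau : exists x, tau x <> x) :
  (fun x : K => `|s x| `^ (1 / 2)) <> (fun x : K => `|s (tau x)| `^ (1 / 2)).
Proof.
have [y [ty y0 _ _]] := quadratic_generator hK htau.
move=> /(congr1 (fun f => f (1 + y))) /=.
rewrite !rmorphD !rmorph1 ty rmorphN div1r !powR12_sqrt ?normr_ge0// => /eqP.
rewrite eqr_sqrt ?normr_ge0//.
have sy0 : s y != 0 by rewrite fmorph_eq0.
by rewrite eqr_norm2 => /orP[]/eqP h; move/eqP: sy0; apply; lra.
Qed.

(** The norm x [tau x] is fixed by [tau], hence rational, and integral, hence a nonzero rational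
    integer. *)
Lemma integral_norm_ge1 (R : realType) (K : fieldExtType rat)
    (hK : \dim {:K} = 2%N) (s : {rmorphism K -> R})
    (tau : {rmorphism K -> K}) (htau : exists x, tau x <> x) (x : K) :
  is_integer x -> x != 0 -> 1 <= `|s x| * `|s (tau x)|.
Proof.
move=> xi x0.
have txi : is_integer (tau x).
  have := integral_rmorph tau xi; case=> p pm pr; exists p => //.
  rewrite (_ : map_poly intr p = map_poly (tau \o intr) p)//.
  by apply: eq_map_poly => z /=; rewrite rmorph_int.
have [y [ty y0 [D yD] gen]] := quadratic_generator hK htau.
have [p [q e]] := gen (x * tau x).
have tauQ := rmorph_alg tau.
have tt z : tau (tau z) = z.
  have [p' [q' ->]] := gen z; rewrite !(rmorphD, rmorphM, tauQ) ty rmorphN ty.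
  by rewrite opprK.
have q0 : q = 0.
  have h : tau (x * tau x) = x * tau x by rewrite rmorphM tt mulrC.
  have : q%:A * y *+ 2 = 0.
    move: h; rewrite e rmorphD rmorphM !tauQ ty mulrN => /addrI h.
    by rewrite mulr2n -{1}h addNr.
  move/eqP; rewrite -mulr_natr !mulf_eq0 (negPf y0) orbF scaler_eq0 oner_eq0 orbF.
  by rewrite -(rmorph_nat (in_alg K)) fmorph_eq0 orbF => /eqP.
rewrite -normrM -rmorphM e q0 scale0r mul0r addr0 rmorph_alg_rat.
have pi : integralOver (intr : int -> rat) p.
  have := integral_mul xi txi; rewrite e q0 scale0r mul0r addr0.
  case=> P Pm Pr; exists P => //.
  have := Pr; rewrite (_ : map_poly intr P = map_poly (in_alg K) (map_poly intr P)).
    by rewrite -[p%:A]/(in_alg K p) fmorph_root.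
  by rewrite -map_poly_comp; apply: eq_map_poly => z /=; rewrite -in_algE rmorph_int.
(* Among the algebraic numbers, a rational algebraic integer is known to be an integer. *)
have pA : ratr p \in (Num.int : {pred algC}).
  apply: Cint_rat_Aint; first exact: Crat_rat.
  have [P Pm Pr] := pi.
  apply: (@root_monic_Aint (map_poly intr P)).
  - have := Pr; rewrite (_ : map_poly (intr : int -> algC) P = map_poly ratr (map_poly intr P)).
      by rewrite fmorph_root.
    by rewrite -map_poly_comp; apply: eq_map_poly => z /=; rewrite rmorph_int.
  - exact: monic_map.
  - by apply/polyOverP => i; rewrite coef_map /=; exact: intr_int.
have [n pn] := intrP pA.
have {}pn : p = n%:~R.
  by apply: (fmorph_inj (ratr : {rmorphism rat -> algC})); rewrite [RHS]rmorph_int; exact: pn.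
have n0 : n != 0.
  apply/eqP => n0; move: e; rewrite q0 pn n0 !scale0r mul0r addr0 => /eqP.
  by rewrite mulf_eq0 fmorph_eq0 orbb (negPf x0).
rewrite pn rmorph_int -intr_norm -(mulr1z 1) ler_int.
by rewrite -gtz0_ge1 normr_gt0.
Qed.

(** * Heights *)

Lemma absolute_value1 (R : realType) (F : fieldType) (v : F -> R) :
  absolute_value v -> v 1 = 1.
Proof.
move=> [v0 v00 vM _]; have := vM 1 1; rewrite mulr1 => e.
have n0 : v 1 != 0 by apply/eqP => /v00/eqP; rewrite oner_eq0.
by apply: (mulfI n0); rewrite -e mulr1.
Qed.

Lemma absolute_valueN (R : realType) (F : fieldType) (v : F -> R) (x : F) :
  absolute_value v -> v (- x) = v x.
Proof.
move=> av; have [v0 v00 vM _] := av.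
have : v (-1) ^+ 2 = 1 by rewrite expr2 -vM mulrNN mulr1 absolute_value1.
move/eqP; rewrite sqrf_eq1 => /orP[/eqP e|/eqP e].
  by rewrite -mulN1r vM e mul1r.
by have := v0 (-1); rewrite e ler0N1.
Qed.

(** If [v x] > 1, the leading term of a monic equation for x strictly dominates the others, whose
    integer coefficients have absolute value at most 1. *)
Lemma ultrametric_integral_le1 (R : realType) (K : fieldExtType rat) (v : K -> R) (x : K) :
  absolute_value v -> ultrametric v -> is_integer x -> v x <= 1.
Proof.
move=> av um; have [v0 v00 vM _] := av; have v1 := absolute_value1 av.
have vX y n : v (y ^+ n) = v y ^+ n.
  by elim: n => [|n ih]; rewrite ?expr0// !exprS vM ih.
have vnat n : v n%:R <= 1.
  elim: n => [|n ih]; first by rewrite (v00 0).2.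
  by rewrite -natr1 (le_trans (um _ _))// ge_max ih v1 lexx.
have vint (n : int) : v n%:~R <= 1.
  case: n => n; first exact: vnat.
  by rewrite NegzE rmorphN absolute_valueN//; exact: vnat.
case=> p pm px; rewrite leNgt; apply/negP => x1.
have p0 : (0 < size p)%N by rewrite size_poly_gt0 monic_neq0.
have vsum (n : nat) (F : nat -> K) (M : R) : 0 <= M -> (forall i, (i < n)%N -> v (F i) <= M) ->
    v (\sum_(i < n) F i) <= M.
  move=> M0; elim: n F => [|n ih] F hF; first by rewrite big_ord0 (v00 0).2.
  rewrite big_ord_recr (le_trans (um _ _))//= ge_max hF// andbT.
  by apply: ih => i ni; apply: hF; rewrite ltnS ltnW.
have szp : size (map_poly intr p : {poly K}) = (size p).-1.+1.
  by rewrite size_map_poly_id0 ?prednK// (monicP pm) oner_neq0.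
have := px; rewrite /root horner_coef szp big_ord_recr /=.
rewrite coef_map /= -lead_coefE (monicP pm) mul1r addrC addr_eq0 => /eqP e.
(* In degree 0 the equation would read 1 = 0. *)
have [m sm] : exists m, (size p).-1 = m.+1.
  case: (size p).-1 e => [|m] e; last by exists m.
  by move: e; rewrite expr0 big_ord0 oppr0 => /eqP; rewrite oner_eq0.
move: e; rewrite sm => /(congr1 v); rewrite vX absolute_valueN//.
have : v (\sum_(i < m.+1) (map_poly intr p)`_i * x ^+ i) <= v x ^+ m.
  apply: (vsum _ (fun i => (map_poly intr p)`_i * x ^+ i)); first by rewrite exprn_ge0.
  move=> i im; rewrite vM vX coef_map /= -[leRHS]mul1r ler_pM// ?exprn_ge0//.
  by rewrite ler_weXn2l// ltW.
by move=> h e; move: h; rewrite -e leNgt exprS ltr_pMl ?x1// exprn_gt0// (lt_trans ltr01).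
Qed.

(** The square of the archimedean part of the height of [X : Y]: the exponents 1/2 of the two places
    are left out. *)
Definition arch_height (R : realType) (K : fieldExtType rat) (s : {rmorphism K -> R})
    (tau : {rmorphism K -> K}) (X Y : K) : R :=
  Num.max `|s X| `|s Y| * Num.max `|s (tau X)| `|s (tau Y)|.

Definition finite_height (R : realType) (K : fieldExtType rat) (x : 'cV[K]_2) : R :=
  \big[*%R/1]_(v \in @finite_place R K) Num.max (v (x 0 0)) (v (x 1 0)).

Lemma heightE (R : realType) (K : fieldExtType rat)
    (hK : \dim {:K} = 2%N) (s : {rmorphism K -> R})
    (tau : {rmorphism K -> K}) (htau : exists x, tau x <> x) (x : 'cV[K]_2) :
  @height R K x = Num.sqrt (arch_height s tau (x 0 0) (x 1 0)) * @finite_height R K x.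
Proof.
rewrite /height -/(@finite_height R K x); congr (_ * _).
rewrite (archimedean_placeE hK s htau) fsbigU0//; last first.
  by move=> v [-> /= e]; exact: (archimedean_place_neq hK htau e).
rewrite !fsbig_set1 /arch_height div1r !powR12_sqrt ?normr_ge0//.
have maxE (a b : R) : Num.max (Num.sqrt `|a|) (Num.sqrt `|b|) = Num.sqrt (Num.max `|a| `|b|).
  have [ab|/ltW ab] := leP `|a| `|b|.
    by rewrite max_r// ler_sqrt.
  by rewrite max_l// ler_sqrt.
by rewrite !maxE sqrtrM// le_max normr_ge0.
Qed.

Lemma finite_height_gt0 (R : realType) (K : fieldExtType rat) (b : K) :
  0 < @finite_height R K (affine_pt b).
Proof.
(* If the support were infinite, the product would take its default value 1. *)
rewrite /finite_height; case: finite_supportP => [_|X XP _ _]; first by rewrite big_nil.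
rewrite big_seq; elim/big_ind: _ => //[x y|v vX]; first exact: mulr_gt0.
have [av _ _] : finite_place v by exact: XP.
by rewrite !mxE /= lt_max (absolute_value1 av) ltr01 orbT.
Qed.

Lemma mulmx_col2 (F : fieldType) (A : 'M[F]_2) (x : 'cV[F]_2) i :
  (A *m x) i 0 = A i 0 * x 0 0 + A i 1 * x 1 0.
Proof. by rewrite mxE !big_ord_recl big_ord0 addr0; congr (_ + A i _ * x _ _); apply/val_inj. Qed.

Lemma det_mx22 (F : comNzRingType) (A : 'M[F]_2) :
  \det A = A 0 0 * A 1 1 - A 0 1 * A 1 0.
Proof.
rewrite (expand_det_row _ ord0) !big_ord_recl big_ord0 /cofactor !det_mx11 !mxE /=.
rewrite addr0 /bump /= expr0 mul1r expr1 mulN1r mulrN.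
by congr (A _ _ * A _ _ - A _ _ * A _ _); apply/val_inj.
Qed.

(* A has integral entries and its inverse too, so that neither increases the
   local factor at an ultrametric absolute value. *)
Lemma finite_height_mul (R : realType) (K : fieldExtType rat) (A : 'M[K]_2) (x : 'cV[K]_2) :
  PSL2pm A -> @finite_height R K (A *m x) = finite_height R x.
Proof.
move=> [Ai detA]; apply: eq_fsbigr => v; rewrite inE => -[av um _].
have [v0 v00 vM _] := av; have v1 := absolute_value1 av.
have le1 i j := ultrametric_integral_le1 av um (Ai i j).
have comb (p q y z : K) : v p <= 1 -> v q <= 1 -> v (p * y + q * z) <= Num.max (v y) (v z).
  move=> p1 q1; rewrite (le_trans (um _ _))// !vM ge_max !le_max.
  by apply/andP; split; apply/orP; [left|right]; rewrite -[leRHS]mul1r ler_wpM2r.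
have vdet : v (\det A) = 1 by case: detA => ->; rewrite ?absolute_valueN.
apply/eqP; rewrite eq_le !mulmx_col2 ge_max !comb//= ge_max.
set X := _ + _; set Y := _ + _.
(* The adjugate matrix applied to (X, Y) gives back x up to the determinant, of absolute value 1. *)
have -> : v (x 0 0) = v (A 1 1 * X + (- A 0 1) * Y).
  by rewrite -[LHS]mul1r -vdet -vM det_mx22 /X /Y; congr v; ring.
have -> : v (x 1 0) = v (- A 1 0 * X + A 0 0 * Y).
  by rewrite -[LHS]mul1r -vdet -vM det_mx22 /X /Y; congr v; ring.
by rewrite !comb// absolute_valueN.
Qed.

Lemma height_mul_affineE (R : realType) (K : fieldExtType rat)
    (hK : \dim {:K} = 2%N) (s : {rmorphism K -> R})
    (tau : {rmorphism K -> K}) (htau : exists x, tau x <> x)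
    (A : 'M[K]_2) (hA : PSL2pm A) (b : K) :
  @height R K (A *m affine_pt b) =
  Num.sqrt (arch_height s tau (A 0 0 * b + A 0 1) (A 1 0 * b + A 1 1))
    * @finite_height R K (affine_pt b).
Proof.
by rewrite (heightE hK s htau) finite_height_mul// !mulmx_col2 !mxE /= !mulr1.
Qed.

Lemma height_affineE (R : realType) (K : fieldExtType rat)
    (hK : \dim {:K} = 2%N) (s : {rmorphism K -> R})
    (tau : {rmorphism K -> K}) (htau : exists x, tau x <> x) (b : K) :
  @height R K (affine_pt b) =
  Num.sqrt (arch_height s tau b 1) * @finite_height R K (affine_pt b).
Proof. by rewrite (heightE hK s htau) !mxE. Qed.

Lemma arch_height_affine_gt0 (R : realType) (K : fieldExtType rat) (s : {rmorphism K -> R})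
    (tau : {rmorphism K -> K}) (b : K) : 0 < arch_height s tau b 1.
Proof. by rewrite mulr_gt0// lt_max !rmorph1 normr1 ltr01 orbT. Qed.

(** Both heights have the same positive factor at the finite places, so the archimedean factors
    decide. *)
Lemma height_mul_compare (R : realType) (K : fieldExtType rat)
    (hK : \dim {:K} = 2%N) (s : {rmorphism K -> R})
    (tau : {rmorphism K -> K}) (htau : exists x, tau x <> x)
    (A : 'M[K]_2) (hA : PSL2pm A) (b : K) :
  let h := arch_height s tau b 1 in
  let hA := arch_height s tau (A 0 0 * b + A 0 1) (A 1 0 * b + A 1 1) in
  [/\ h < hA -> @height R K (affine_pt b) < height R (A *m affine_pt b),
      hA < h -> @height R K (A *m affine_pt b) < height R (affine_pt b)
    & hA = h -> @height R K (A *m affine_pt b) = height R (affine_pt b)].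
Proof.
move=> h hA'; rewrite (height_affineE hK s htau) (height_mul_affineE hK s htau hA).
rewrite -/h -/hA'; have h0 : 0 < h := arch_height_affine_gt0 s tau b.
split=> [lth|lth|->//]; rewrite ltr_pM2r ?finite_height_gt0// ltr_sqrt//.
exact: lt_trans lth.
Qed.

(** * The extended half-line *)

Section ExtendedReals.
Variable R : realType.
Implicit Types (x y : \bar R) (E : set (\bar R)).

(** The bounds are the infimum and the supremum, each included exactly when it lies in E.
    [BSide true] is closed as a lower bound and open as an upper one, whence the negation. *)
Lemma interval_set_convex E :
  (forall x y z, E x -> E z -> (x <= y)%E -> (y <= z)%E -> E y) -> interval_set E.
Proof.
move=> cE; exists (Interval (BSide `[< E (ereal_inf E) >] (ereal_inf E))
                     (BSide (~~ `[< E (ereal_sup E) >]) (ereal_sup E))).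
apply/seteqP; split => y /=; rewrite in_itv /= negbK.
- move=> Ey; apply/andP; split.
  + have := ereal_inf_lbound Ey.
    case: asboolP => // nE; rewrite /= le_eqVlt => /orP[/eqP e|//].
    by case: nE; rewrite e.
  + have := ereal_sup_ubound Ey.
    case: asboolP => // nE; rewrite /= le_eqVlt => /orP[/eqP e|//].
    by case: nE; rewrite -e.
- move=> /andP[l r].
  have [x Ex xy] : exists2 x, E x & (x <= y)%E.
    move: l; case: asboolP => [Ei|_] l; first by exists (ereal_inf E).
    by have [x Ex xy] := ereal_inf_lt l; exists x => //; exact: ltW.
  have [z Ez yz] : exists2 z, E z & (y <= z)%E.
    move: r; case: asboolP => [Es|_] r; first by exists (ereal_sup E).
    by have [z Ez yz] := ereal_sup_gt r; exists z => //; exact: ltW.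
  exact: cE Ex Ez xy yz.
Qed.

(** Turns a neighbourhood of x, which may be an endpoint or +oo, into an interval of reals where
    elements of K can be found; x itself may lie outside it. *)
Lemma near_interval (lo x hi : \bar R) (W : set (\bar R)) :
  (0 <= lo)%E -> (lo <= x)%E -> (x <= hi)%E -> (lo < hi)%E -> nbhs x W ->
  exists u v : R, [/\ u < v, (lo <= u%:E)%E, (v%:E <= hi)%E
    & forall r, u < r < v -> W r%:E].
Proof.
move=> lo0 lox xhi lohi; case: x lox xhi => [x||] lox xhi; last first.
- by have := le_trans lo0 lox.
- case=> M [_ hM].
  have [l lE] : exists l, lo = l%:E.
    case: lo lo0 lohi {lox} => [l||] //; first by exists l.
    by move=> _; rewrite ltNge leey.
  exists (Num.max l M), (Num.max l M + 1); split.
  + by rewrite ltrDl.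
  + by rewrite lE lee_fin le_max lexx.
  + by rewrite (le_trans _ xhi)// leey.
  + by move=> r /andP[]; rewrite gt_max => /andP[_ Mr] _; apply: hM; rewrite lte_fin.
move=> /nbhs_EFin/nbhs_ballP[e /= e0 he].
have hW r : x - e < r -> r < x + e -> W r%:E.
  by move=> h1 h2; apply: he; rewrite /ball /= ltr_norml; apply/andP; split; lra.
have [xh|xh] := ltP x%:E hi.
- have [v [xv vhi ve]] : exists v, [/\ x < v, (v%:E <= hi)%E & v <= x + e].
    case: hi xh {xhi lohi} => [h||] // xh.
    + exists (Num.min h (x + e)); rewrite lt_min lee_fin !ge_min !lexx orbT.
      by split=> //; rewrite -lte_fin xh /= ltrDl.
    + by exists (x + e); rewrite ltrDl leey.
  exists x, v; split=> // r /andP[h1 h2]; apply: hW; lra.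
(* At the right endpoint, the interval is taken on the left of x. *)
- have hE : hi = x%:E by apply/eqP; rewrite eq_le xhi xh.
  have [l lE] : exists l, lo = l%:E.
    case: lo lo0 lohi {lox} => [l||] //; first by exists l.
    by move=> _; rewrite ltNge leey.
  exists (Num.max l (x - e)), x; split=> //.
  + by rewrite gt_max ltrBlDr ltrDl e0 andbT -lte_fin -lE -hE.
  + by rewrite lE lee_fin le_max lexx.
  + by move=> r /andP[]; rewrite gt_max => /andP[h1 h2] h3; apply: hW; lra.
Qed.

(** Such a set contains an interval of reals, hence its three quarter points, which two points
    cannot cover. *)
Lemma proper_interval_not_le2 E x y :
  E `<=` @pospart R -> proper_interval E -> ~ E `<=` [set x; y].
Proof.
move=> Epos [[i Ei] [p [q [Ep Eq pq]]]] Exy.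
have [u [v [uv pu vq _]]] := near_interval (Epos _ Ep) (lexx p) (ltW pq) pq filterT.
have Er r : u < r < v -> E r%:E.
  move=> /andP[ur rv]; have Ep' := Ep; have Eq' := Eq.
  move: Ep' Eq'; rewrite Ei /=; case: i Ei => lo hi _.
  rewrite !itv_boundlr => /andP[lp _] /andP[_ qh]; apply/andP; split.
    by rewrite (le_trans lp)// bnd_simp (le_trans pu)// lee_fin ltW.
  by rewrite (le_trans _ qh)// bnd_simp (le_trans _ vq)// lee_fin ltW.
pose r k := u + (v - u) * k / 4.
have rE k : 0 < k < 4 -> E (r k)%:E.
  move=> /andP[k0 k4]; apply: Er; apply/andP; split.
    by rewrite /r ltrDl divr_gt0// mulr_gt0 ?subr_gt0.
  rewrite /r -ltrBrDl ltr_pdivrMr// ltr_pM2l ?subr_gt0//.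
have rinj j k : (r j)%:E = (r k)%:E -> j = k.
  have d0 : v - u != 0 by rewrite subr_eq0 gt_eqF.
  by move=> [] /addrI e; apply: (mulfI d0); lra.
have e1 := Exy _ (rE 1 _); have e2 := Exy _ (rE 2 _); have e3 := Exy _ (rE 3 _).
have n12 : (1 : R) <> 2 by lra.
have n13 : (1 : R) <> 3 by lra.
have n23 : (2 : R) <> 3 by lra.
case: e1 => [|e1|e1]; first lra; (case: e2 => [|e2|e2]; first lra);
  (case: e3 => [|e3|e3]; first lra);
  by [case: n12; apply: rinj; rewrite e1 e2|case: n13; apply: rinj; rewrite e1 e3|
      case: n23; apply: rinj; rewrite e2 e3].
Qed.

Lemma rel_dense_near (D E : set (\bar R)) : D `<=` E -> E `<=` @pospart R ->
  (forall x W, E x -> nbhs x W -> exists2 y, D y & W y) -> rel_dense D E.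
Proof.
move=> DE Epos h; split=> // x Ex.
rewrite closure_subspaceW; last exact: subset_trans Epos.
by split; [move=> W /(h _ _ Ex)[y Dy Wy]; exists y|exact: Epos].
Qed.

Lemma rel_boundary_closure E x : E `<=` @pospart R -> rel_boundary E x ->
  [/\ @pospart R x, closure E x & closure (@pospart R `\` E) x].
Proof.
move=> Epos; rewrite /rel_boundary !closure_subspaceW//.
by move=> [[? ?] [? ?]].
Qed.

Lemma closure_ge (g : \bar R -> R) E (t : R) x : continuous g ->
  (forall y, E y -> t <= g y) -> closure E x -> t <= g x.
Proof.
move=> gc h cl; rewrite leNgt; apply/negP => gx.
have [y [Ey /=]] := cl _ (gc x _ (lt_nbhsl gx)).
by rewrite ltNge h.
Qed.

(* A point x of [0, oo] has the homogeneous coordinates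
   [num_part x : den_part x], whose maximum is 1. *)
Definition num_part x : R :=
  match x with r%:E => Num.max 0 (Num.min r 1) | +oo%E => 1 | -oo%E => 0 end.

Definition den_part x : R :=
  match x with r%:E => (Num.max r 1)^-1 | +oo%E => 0 | -oo%E => 1 end.

(** On the negative side the coordinates are frozen at [0 : 1], which makes them continuous on all
    extended reals and not only on [0, oo]. *)
Lemma num_part_continuous : continuous num_part.
Proof.
move=> [r||] U /=.
- move=> hU; apply/nbhs_EFin.
  have : {for r, continuous (fun r : R => Num.max 0 (Num.min r 1))}.
    apply: continuous_max; first exact: cvg_cst.
    by apply: continuous_min => //; exact: cvg_cst.
  exact.
- move=> /nbhs_singleton U1; exists 1; split=> // -[y||] //=.
  by rewrite lte_fin => /ltW y1; rewrite min_r// max_r.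
- move=> /nbhs_singleton U1; exists 0; split=> // -[y||] //=.
  by rewrite lte_fin => /ltW y1; rewrite min_l ?max_l// (le_trans y1).
Qed.

Lemma den_part_continuous : continuous den_part.
Proof.
have m0 (r : R) : 0 < Num.max r 1 by rewrite lt_max ltr01 orbT.
move=> [r||] U /=.
- move=> hU; apply/nbhs_EFin.
  have : {for r, continuous (fun r : R => (Num.max r 1)^-1)}.
    apply: cvgV; first by rewrite gt_eqF.
    by apply: continuous_max => //; exact: cvg_cst.
  exact.
- move=> /nbhs_ballP[e /= e0 he]; exists e^-1; split; first exact: num_real.
  move=> [y||] //= ye; apply: he; last exact: ballxx.
  rewrite /ball /= sub0r normrN ger0_norm ?invr_ge0 1?ltW//.
  by rewrite invf_plt ?posrE// lt_max -lte_fin ye.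
- move=> /nbhs_singleton U1; exists 0; split=> // -[y||] //=.
  by rewrite lte_fin => /ltW y1; rewrite max_r ?invr1// (le_trans y1).
Qed.

End ExtendedReals.

(** * Maximum norms and 2x2 matrices *)

Section RealMatrices.
Variable R : realType.
Implicit Types a b c d y z : R.

(** For determinant 1 or -1, the columns of the matrix hold, up to sign and order, the rows of its
    inverse: this is the operator norm of the inverse for the maximum norm. *)
Definition row_sum_norm a b c d := Num.max (`|a| + `|c|) (`|b| + `|d|).

Definition max_norm_image a b c d y z := Num.max `|a * y + b * z| `|c * y + d * z|.

Lemma row_sum_norm_swap_rows a b c d : row_sum_norm c d a b = row_sum_norm a b c d.
Proof. by rewrite /row_sum_norm addrC [`|d| + _]addrC. Qed.

Lemma row_sum_norm_swap_cols a b c d : row_sum_norm b a d c = row_sum_norm a b c d.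
Proof. exact: maxC. Qed.

Lemma max_norm_image_swap_rows a b c d y z :
  max_norm_image c d a b y z = max_norm_image a b c d y z.
Proof. exact: maxC. Qed.

Lemma max_norm_image_swap_cols a b c d y z :
  max_norm_image b a d c y z = max_norm_image a b c d z y.
Proof. by rewrite /max_norm_image addrC [d * y + _]addrC. Qed.

Lemma max_norm_image_ge0 a b c d y z : 0 <= max_norm_image a b c d y z.
Proof. by rewrite le_max normr_ge0. Qed.

(** By Cramer's rule, y is up to sign the combination of the coordinates of the image with
    coefficients d and -b. *)
Lemma norm_le_image a b c d y z : `|a * d - b * c| = 1 ->
  `|y| <= (`|b| + `|d|) * max_norm_image a b c d y z.
Proof.
move=> det1; set M := max_norm_image _ _ _ _ _ _.
have h1 : `|a * y + b * z| <= M by rewrite le_max lexx.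
have h2 : `|c * y + d * z| <= M by rewrite le_max lexx orbT.
rewrite -[`|y|]mul1r -det1 -normrM.
have -> : (a * d - b * c) * y = d * (a * y + b * z) - b * (c * y + d * z) by ring.
rewrite (le_trans (ler_normB _ _))// !normrM addrC mulrDl.
by rewrite lerD// ler_wpM2l.
Qed.

(** Equality in the triangle inequality leaves no slack in either term; as b and d are nonzero, both
    coordinates of the image reach the maximum. *)
Lemma norm_eq_image a b c d y z : `|a * d - b * c| = 1 -> b != 0 -> d != 0 ->
  `|y| = (`|b| + `|d|) * max_norm_image a b c d y z ->
  `|a * y + b * z| = `|c * y + d * z|.
Proof.
move=> det1 b0 d0; set M := max_norm_image _ _ _ _ _ _.
have h1 : `|a * y + b * z| <= M by rewrite le_max lexx.
have h2 : `|c * y + d * z| <= M by rewrite le_max lexx orbT.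
rewrite -[`|y|]mul1r -det1 -normrM.
have -> : (a * d - b * c) * y = d * (a * y + b * z) - b * (c * y + d * z) by ring.
move=> e; have := ler_normB (d * (a * y + b * z)) (b * (c * y + d * z)).
rewrite e !normrM.
have {}b0 : 0 < `|b| by rewrite normr_gt0.
have {}d0 : 0 < `|d| by rewrite normr_gt0.
have g1 : `|d| * `|a * y + b * z| <= `|d| * M by rewrite ler_wpM2l.
have g2 : `|b| * `|c * y + d * z| <= `|b| * M by rewrite ler_wpM2l.
move=> g.
have e1 : `|d| * `|a * y + b * z| = `|d| * M by lra.
have e2 : `|b| * `|c * y + d * z| = `|b| * M by lra.
by rewrite (mulfI (lt0r_neq0 d0) e1) (mulfI (lt0r_neq0 b0) e2).
Qed.

Lemma det_swap_cols a b c d : `|a * d - b * c| = 1 -> `|b * c - a * d| = 1.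
Proof. by rewrite distrC. Qed.

Lemma max_norm_le_image a b c d y z : `|a * d - b * c| = 1 ->
  Num.max `|y| `|z| <= row_sum_norm a b c d * max_norm_image a b c d y z.
Proof.
move=> det1; have M0 := max_norm_image_ge0 a b c d y z.
have h1 := norm_le_image y z det1.
have := norm_le_image z y (det_swap_cols det1); rewrite max_norm_image_swap_cols => h2.
by rewrite ge_max (le_trans h1) ?(le_trans h2)// ler_wpM2r// le_max lexx ?orbT.
Qed.

Lemma norm_eq_max_image a b c d y z : `|a * d - b * c| = 1 ->
  a != 0 -> b != 0 -> c != 0 -> d != 0 ->
  Num.max `|y| `|z| = row_sum_norm a b c d * max_norm_image a b c d y z ->
  `|a * y + b * z| = `|c * y + d * z|.
Proof.
move=> det1 a0 b0 c0 d0.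
have M0 := max_norm_image_ge0 a b c d y z.
have [zy|/ltW yz] := leP `|z| `|y|.
  move=> e; apply: (norm_eq_image det1 b0 d0); apply/eqP.
  by rewrite eq_le norm_le_image//= e ler_wpM2r// le_max lexx orbT.
move=> e; rewrite [in LHS]addrC [in RHS]addrC.
apply: (norm_eq_image (det_swap_cols det1) a0 c0); apply/eqP.
rewrite eq_le (norm_le_image _ _ (det_swap_cols det1))/= e max_norm_image_swap_cols.
by rewrite ler_wpM2r// le_max lexx.
Qed.

Lemma sign_exists y : exists2 e : R, `|e| = 1 & e * y = `|y|.
Proof.
have [y0|y0] := leP 0 y; first by exists 1; rewrite ?normr1// mul1r ger0_norm.
by exists (-1); rewrite ?normrN1// mulN1r ltr0_norm.
Qed.

(* The inverse matrix applied to a vector of signs chosen so that one coordinate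
   is the sum of the absolute values of a row. *)
Lemma max_norm_image_attained a b c d : `|a * d - b * c| = 1 ->
  exists y z, Num.max `|y| `|z| = row_sum_norm a b c d /\ max_norm_image a b c d y z = 1.
Proof.
(* Once the second column has the larger sum, the first coordinate of the vector realizes the
   norm. *)
wlog le_cols : a b c d / `|a| + `|c| <= `|b| + `|d| => [wl|] det1.
  have [h|/ltW h] := leP (`|a| + `|c|) (`|b| + `|d|); first exact: wl.
  have [y [z [h1 h2]]] := wl _ _ _ _ h (det_swap_cols det1).
  by exists z, y; rewrite maxC h1 row_sum_norm_swap_cols -max_norm_image_swap_cols.
have [e ne ed] := sign_exists d; have [g ng gb] := sign_exists b.
set D := a * d - b * c in det1.
have D2 : D * D = 1 by rewrite -expr2 -real_normK ?num_real// det1 expr1n.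
(* The inverse matrix applied to (e, -g); D is its own inverse. *)
exists (D * (e * d + g * b)), (D * (- g * a - c * e)).
rewrite /row_sum_norm [X in _ = X /\ _]max_r//; split.
  have h : `|- g * a - c * e| <= `|b| + `|d|.
    by rewrite (le_trans _ le_cols)// (le_trans (ler_normB _ _))// !normrM normrN ng ne mul1r mulr1.
  by rewrite ed gb !normrM det1 !mul1r ger0_norm ?addr_ge0// [`|d| + _]addrC max_l.
rewrite /max_norm_image.
have -> : a * (D * (e * d + g * b)) + b * (D * (- g * a - c * e)) = e.
  by rewrite -[RHS]mul1r -D2 /D; ring.
have -> : c * (D * (e * d + g * b)) + d * (D * (- g * a - c * e)) = - g.
  by rewrite -[RHS]mul1r -D2 /D; ring.
by rewrite normrN ng ne maxxx.
Qed.

Lemma max_norm_affine_continuous (p q r w : R) :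
  continuous (fun y : R => Num.max `|p + q * y| `|r + w * y|).
Proof.
have aff (p' q' : R) : continuous (fun y : R => `|p' + q' * y|).
  move=> y; apply: cvg_norm; apply: cvgD; first exact: cvg_cst.
  by apply: cvgMr; exact: cvg_id.
move=> y; exact: (@continuous_max R R (fun y => `|p + q * y|)
  (fun y => `|r + w * y|) y (aff p q y) (aff r w y)).
Qed.

(** General affine coefficients allow either coordinate of a vector to be the one that varies. *)
Lemma open_interval_lt (F p q r w p' q' r' w' y : R) :
  F * Num.max `|p + q * y| `|r + w * y| < Num.max `|p' + q' * y| `|r' + w' * y| ->
  exists2 e : R, 0 < e & forall z, y - e < z < y + e ->
    F * Num.max `|p + q * z| `|r + w * z| < Num.max `|p' + q' * z| `|r' + w' * z|.
Proof.
rewrite -subr_gt0 => h.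
have c : {for y, continuous (fun z => Num.max `|p' + q' * z| `|r' + w' * z| -
  F * Num.max `|p + q * z| `|r + w * z|)}.
  apply: cvgB; first exact: max_norm_affine_continuous.
  by apply: cvgMr; exact: max_norm_affine_continuous.
have /nbhs_ballP[e /= e0 he] := c _ (lt_nbhsr h).
exists e => // z /andP[z1 z2]; rewrite -subr_gt0; apply: he.
by rewrite /ball /= ltr_norml; apply/andP; split; lra.
Qed.

(** The strict inequality holds at a vector attaining the norm of the inverse. Being open, it
    survives a move away from z = 0; by homogeneity z becomes 1, and openness in y gives the
    interval. *)
Lemma contracting_interval (F a b c d : R) : `|a * d - b * c| = 1 ->
  F < row_sum_norm a b c d ->
  exists p q, p < q /\ forall y, p < y < q ->
    F * max_norm_image a b c d y 1 < Num.max `|y| 1.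
Proof.
move=> det1; have [y [z [<- im1]]] := max_norm_image_attained det1 => Ft.
have {im1}Fyz : F * max_norm_image a b c d y z < Num.max `|y| `|z| by rewrite im1 mulr1.
have [z' z0 {}Fyz] : exists2 z', z' != 0 & F * max_norm_image a b c d y z' < Num.max `|y| `|z'|.
  have [z0|z0] := eqVneq z 0; last by exists z.
  have [|e e0 he] := @open_interval_lt F (a * y) b (c * y) d y 0 0 1 z.
    by rewrite mul0r mul1r addr0 add0r.
  exists (z + e / 2); first by rewrite z0 add0r gt_eqF// divr_gt0.
  have := he (z + e / 2); rewrite mul0r mul1r addr0 add0r; apply; apply/andP; split; lra.
have [|e e0 he] := @open_interval_lt F b a d c 0 1 1 0 (y / z').
  rewrite mul1r mul0r add0r addr0.
  have z'0 : 0 < `|z'| by rewrite normr_gt0.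
  rewrite -(ltr_pM2r z'0) -mulrA !maxr_pMl ?normr_ge0// -!normrM.
  have -> : (b + a * (y / z')) * z' = a * y + b * z' by field.
  have -> : (d + c * (y / z')) * z' = c * y + d * z' by field.
  by rewrite divfK// mul1r.
exists (y / z' - e), (y / z' + e); split; first by lra.
move=> w /he; rewrite mul1r mul0r add0r addr0 normr1.
by rewrite /max_norm_image !mulr1 ![_ + _ * w]addrC.
Qed.

End RealMatrices.

(** * Level segments of the stretch *)

Section QuadraticField.
Variables (R : realType) (K : fieldExtType rat) (hK : \dim {:K} = 2%N).
Variables (s : {rmorphism K -> R}) (tau : {rmorphism K -> K}).
Variable htau : exists x, tau x <> x.
Implicit Types a b c d : K.

(* Both the rows and the columns of an admissible quadruple can be exchanged;
   exchanging the columns amounts to the substitution x -> 1 / x. *)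
Definition admissible a b c d : Prop :=
  [/\ [/\ is_integer a, is_integer b, is_integer c & is_integer d],
      a * d - b * c = 1 \/ a * d - b * c = -1,
      [/\ 0 <= s a, 0 <= s b, 0 <= s c & 0 <= s d],
      a = 0 -> d <> 0 & b = 0 -> c <> 0].

Lemma admissible_swap_rows a b c d : admissible a b c d -> admissible c d a b.
Proof.
move=> [[ai bi ci di] det [a0 b0 c0 d0] ad bc]; split=> //.
- by rewrite mulrC (mulrC d) -opprB; case: det => ->; rewrite ?opprK; [right|left].
- by move=> h1 h2; exact: bc.
- by move=> h1 h2; exact: ad.
Qed.

Lemma admissible_swap_cols a b c d : admissible a b c d -> admissible b a d c.
Proof.
move=> [[ai bi ci di] det [a0 b0 c0 d0] ad bc]; split=> //.
by rewrite -opprB; case: det => ->; rewrite ?opprK; [right|left].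
Qed.

(** The threshold t, as a function of the four entries so that rows and columns can be exchanged. *)
Definition conj_norm a b c d : R :=
  row_sum_norm (s (tau a)) (s (tau b)) (s (tau c)) (s (tau d)).

Lemma conj_det a b c d : a * d - b * c = 1 \/ a * d - b * c = -1 ->
  `|s (tau a) * s (tau d) - s (tau b) * s (tau c)| = 1.
Proof.
by rewrite -!rmorphM -!rmorphB => -[->|->]; rewrite ?rmorphN !rmorph1 ?normrN normr1.
Qed.

(** The determinant is -bc, and the nonnegativity of b and c selects its sign. *)
Lemma antidiagonal_unit b c d : admissible 0 b c d -> s b * s c = 1.
Proof.
move=> [_ det [_ b0 c0 _] _ _]; rewrite -rmorphM; case: det; rewrite mul0r sub0r => e.
  have := mulr_ge0 b0 c0; rewrite -rmorphM -[b * c]opprK e rmorphN rmorph1; lra.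
by rewrite -[b * c]opprK e opprK rmorph1.
Qed.

(* If c + d > b, then b - d is a nonzero integer smaller than c = 1 / b, while
   its conjugate is at most |b'| + |d'| <= b. *)
Lemma level_segment_row a b c d (x y : R) : admissible a b c d ->
  0 <= x -> x < y -> s a * x + s b = conj_norm a b c d ->
  max_norm_image (s a) (s b) (s c) (s d) y 1 <= conj_norm a b c d ->
  [/\ a = 0, s b = conj_norm a b c d & s c + s d <= s b].
Proof.
move=> adm x0 xy ex; rewrite ge_max !mulr1.
have [[ai bi ci di] det [a0 b0 c0 d0] ad bc] := adm.
move=> /andP[/(le_trans (ler_norm _)) h1 /(le_trans (ler_norm _)) h2].
have y0 : 0 < y by exact: le_lt_trans xy.
(* The first row equals t at x and is at most t at y > x, so its slope a is not positive. *)
have az : a = 0.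
  apply/eqP; rewrite -(fmorph_eq0 s) eq_le a0 andbT.
  by rewrite -(pmulr_lle0 _ (_ : 0 < y - x)) ?subr_gt0//; lra.
have bE : s b = conj_norm a b c d by rewrite -ex az rmorph0 mul0r add0r.
split=> //; rewrite leNgt; apply/negP => lt.
have bc1 : s b * s c = 1 by apply: (@antidiagonal_unit b c d); rewrite -az.
have b1 : 0 < s b by rewrite lt0r b0 andbT; apply/eqP => e; move: bc1; rewrite e mul0r; lra.
have c1 : 0 < s c by rewrite -(pmulr_rgt0 _ b1) bc1.
have db : s d < s b by have := mulr_gt0 c1 y0; rewrite -bE in h2; lra.
have bd0 : b - d != 0.
  by rewrite subr_eq0; apply/eqP => e; move: db; rewrite e ltxx.
have := integral_norm_ge1 hK s htau (integral_sub bi di) bd0.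
apply/negP; rewrite -ltNge rmorphB ger0_norm ?subr_ge0 ?ltW//.
have h3 : `|s (tau (b - d))| <= s b.
  by rewrite !rmorphB (le_trans (ler_normB _ _))// bE le_max lexx orbT.
rewrite (le_lt_trans (ler_wpM2l _ h3)) ?subr_ge0 1?ltW//.
by rewrite -bc1 [ltRHS]mulrC ltr_pM2r//; lra.
Qed.

(* The consequences of f = t on a segment of [0, 1]. In the last one, z stands
   for the conjugate of beta, and the bound is |beta'| <= 1: then f(beta) = t
   makes the heights of beta and A * beta equal. *)
Definition level_structure a b c d : Prop :=
  [/\ forall x : R, 0 <= x <= 1 ->
        max_norm_image (s a) (s b) (s c) (s d) x 1 = conj_norm a b c d,
      forall k : R, 0 <= k <= 1 ->
        max_norm_image (s a) (s b) (s c) (s d) 1 k = conj_norm a b c d -> k = 1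
    & exists p q : R, p < q /\ forall z, p < z < q -> `|z| <= 1 /\
        conj_norm a b c d * max_norm_image (s (tau a)) (s (tau b)) (s (tau c)) (s (tau d)) z 1 = 1].

(** The bounds |c'| <= t = b and c |c'| >= 1 = b c force |c'| = b, hence |b'| = c and |d'| <= b - c.
    Near -d'/c' the second row c' z + d' is dominated by |b'| = c, so the image has norm c, and t c
    = b c = 1. *)
Lemma level_structure_row b c d : admissible 0 b c d ->
  s b = conj_norm 0 b c d -> s c + s d <= s b -> level_structure 0 b c d.
Proof.
move=> adm bE cd; have [[_ bi ci di] det [_ b0 c0 d0] ad bc] := adm.
have bc1 := antidiagonal_unit adm.
have b1 : 0 < s b by rewrite lt0r b0 andbT; apply/eqP => e; move: bc1; rewrite e mul0r; lra.
have c1 : 0 < s c by rewrite -(pmulr_rgt0 _ b1) bc1.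
have d1 : 0 < s d by rewrite lt0r d0 andbT fmorph_eq0; apply/eqP; exact: ad.
have bc' : `|s (tau b)| * `|s (tau c)| = 1.
  by have := conj_det det; rewrite !rmorph0 mul0r sub0r normrN normrM.
have cz : c != 0 by rewrite -(fmorph_eq0 s) gt_eqF.
have c'b : `|s (tau c)| = s b.
  apply/eqP; rewrite eq_le; apply/andP; split.
    by rewrite bE le_max !rmorph0 normr0 add0r lexx.
  have := integral_norm_ge1 hK s htau ci cz; rewrite gtr0_norm// => h.
  by rewrite -(ler_pM2l c1) mulrC bc1.
have b'c : `|s (tau b)| = s c.
  by apply: (mulIf (lt0r_neq0 b1)); rewrite -{1}c'b bc' mulrC.
have d'le : `|s (tau d)| <= s b - s c.
  have : `|s (tau b)| + `|s (tau d)| <= s b by rewrite bE le_max lexx orbT.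
  by rewrite b'c; lra.
rewrite /level_structure -bE /max_norm_image !rmorph0; split.
- move=> x /andP[x0 x1]; rewrite mul0r add0r !mulr1 gtr0_norm// max_l// ger0_norm.
    by rewrite (le_trans _ cd)// lerD2r ger_pMr.
  by rewrite addr_ge0// mulr_ge0.
(* For k < 1 both rows stay below b: b k < b and, as d > 0, c + d k < c + d <= b. *)
- move=> k /andP[k0 k1] e; apply/eqP; rewrite eq_le k1 leNgt; apply/negP => lt1.
  have : Num.max `|0 * 1 + s b * k| `|s c * 1 + s d * k| < s b; last by rewrite e ltxx.
  rewrite mul0r add0r mulr1 gt_max !ger0_norm ?addr_ge0 ?mulr_ge0//.
  rewrite gtr_pMr// lt1 /= (lt_le_trans _ cd)// ltrD2l gtr_pMr//.
- set b' := s (tau b) in bc' b'c *; set c' := s (tau c) in bc' c'b *.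
  set d' := s (tau d) in d'le *.
  have c'0 : c' != 0 by rewrite -normr_gt0 c'b.
  (* The radius c^2 keeps |c' z + d'| at most b c^2 = c, and |z| at most c^2 + (b - c) c = 1. *)
  exists (- d' / c' - s c ^+ 2), (- d' / c' + s c ^+ 2); split.
    by have := exprn_gt0 2 c1; lra.
  move=> z /andP[z1 z2].
  have zd : `|z + d' / c'| <= s c ^+ 2 by rewrite ler_norml; apply/andP; split; lra.
  split.
    have -> : z = (z + d' / c') - d' / c' by ring.
    rewrite (le_trans (ler_normB _ _))// (le_trans (lerD zd (lexx _)))//.
    have -> : `|d' / c'| = `|d'| * s c.
      rewrite normrM normfV c'b; congr (_ * _).
      by apply: (mulfI (lt0r_neq0 b1)); rewrite bc1 divff ?lt0r_neq0.
    have : `|d'| * s c <= (s b - s c) * s c by rewrite ler_pM2r.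
    by rewrite mulrBl bc1 expr2; lra.
  rewrite mul0r add0r !mulr1 max_l ?b'c//.
  have -> : c' * z + d' = c' * (z + d' / c') by field.
  rewrite normrM c'b (le_trans (ler_wpM2l _ zd))//.
  by rewrite expr2 mulrA bc1 mul1r.
Qed.

Lemma level_structure_swap_rows a b c d :
  level_structure c d a b -> level_structure a b c d.
Proof.
rewrite /level_structure /conj_norm row_sum_norm_swap_rows => -[h1 h2 [p [q [pq h3]]]].
split.
- by move=> x /h1 <-; rewrite max_norm_image_swap_rows.
- by move=> k kI; rewrite -max_norm_image_swap_rows; exact: h2.
- exists p, q; split=> // z /h3[z1 e]; split=> //.
  by rewrite -max_norm_image_swap_rows.
Qed.

(** Up to an exchange of rows, the first row attains the maximum at the left end x, which is the
    situation of [level_segment_row]. *)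
Lemma level_segment a b c d (x y : R) : admissible a b c d ->
  0 <= x -> x < y ->
  max_norm_image (s a) (s b) (s c) (s d) x 1 = conj_norm a b c d ->
  max_norm_image (s a) (s b) (s c) (s d) y 1 = conj_norm a b c d ->
  level_structure a b c d.
Proof.
wlog row1 : a b c d / max_norm_image (s a) (s b) (s c) (s d) x 1 = s a * x + s b.
  move=> wl adm x0 xy ex ey; have [_ _ [a0 b0 c0 d0] _ _] := adm.
  have [h|h] := leP (s c * x + s d) (s a * x + s b).
    apply: wl ex ey => //.
    by rewrite /max_norm_image !mulr1 !ger0_norm ?addr_ge0 ?mulr_ge0// max_l.
  apply: level_structure_swap_rows; apply: wl => //.
  - rewrite /max_norm_image !mulr1 !ger0_norm ?addr_ge0 ?mulr_ge0// max_l// ltW//.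
  - exact: admissible_swap_rows.
  - by rewrite max_norm_image_swap_rows ex /conj_norm row_sum_norm_swap_rows.
  - by rewrite max_norm_image_swap_rows ey /conj_norm row_sum_norm_swap_rows.
move=> adm x0 xy; rewrite row1 => ex ey.
have [az bE cd] := level_segment_row adm x0 xy ex (eq_ind_r (fun t => t <= _) (lexx _) ey).
by rewrite az in adm bE *; exact: level_structure_row.
Qed.

End QuadraticField.

(** * The stretch in homogeneous coordinates *)

Lemma admissible_entries (R : realType) (K : fieldExtType rat) (s : {rmorphism K -> R})
    (A : 'M[K]_2) : PSL2pm A -> positive_mx s A -> nonneg_entries s A ->
  admissible s (A 0 0) (A 0 1) (A 1 0) (A 1 1).
Proof.
move=> [Ai detA] [B BA [_ card1]] A0.
have uniq0 (i j : 'I_2 * 'I_2) : A i.1 i.2 = 0 -> A j.1 j.2 = 0 -> i = j.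
  move=> hi hj; have /card_le1_eqP := card1; apply; rewrite inE /=;
  by case: BA => ->; rewrite ?mxE ?hi ?hj ?oppr0 eqxx.
split=> //; first by rewrite -det_mx22.
- by move=> h1 h2; have := uniq0 (0, 0) (1, 1) h1 h2.
- by move=> h1 h2; have := uniq0 (0, 1) (1, 0) h1 h2.
Qed.

Section HomogeneousCoordinates.
Variable R : realType.
Implicit Types x y : \bar R.

Lemma num_part_itv x : 0 <= num_part x <= 1.
Proof.
case: x => [r||] /=; rewrite ?lexx ?ler01//.
by rewrite le_max lexx /= ge_max ler01 ge_min lexx orbT.
Qed.

Lemma den_part_itv x : 0 <= den_part x <= 1.
Proof.
case: x => [r||] /=; rewrite ?lexx ?ler01//.
rewrite invr_ge0 le_max ler01 orbT /=.
by rewrite invf_le1 ?le_max ?lexx ?orbT// lt_max ltr01 orbT.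
Qed.

Lemma num_part_le1 (r : R) : 0 <= r <= 1 -> num_part r%:E = r.
Proof. by move=> /andP[r0 r1]; rewrite /= min_l// max_r. Qed.

Lemma den_part_le1 x : (x <= 1%:E)%E -> den_part x = 1.
Proof. by case: x => [r||] //=; rewrite lee_fin => r1; rewrite max_r ?invr1. Qed.

Lemma num_part_ge1 x : (1%:E <= x)%E -> num_part x = 1.
Proof. by case: x => [r||] //=; rewrite lee_fin => r1; rewrite min_r// max_r. Qed.

Lemma den_part_ge1 (r : R) : 1 <= r -> den_part r%:E = r^-1.
Proof. by move=> r1; rewrite /= max_l. Qed.

Lemma num_part_le x y : (x <= y)%E -> num_part x <= num_part y.
Proof.
case: y => [r||] //.
- case: x => [q||] //.
  + by rewrite lee_fin => qr /=; rewrite ge_max !le_max lexx /= le_min !ge_min qr lexx ?orbT.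
  + by move=> _; case/andP: (num_part_itv r%:E).
- by move=> _; case/andP: (num_part_itv x).
- by rewrite leeNy_eq => /eqP ->.
Qed.

Lemma den_part_lt x y : (1%:E <= x)%E -> (x < y)%E -> den_part y < den_part x.
Proof.
case: x => [q||] //; last by move=> _; rewrite ltNge leey.
rewrite lee_fin => q1; case: y => [r||] // qr; rewrite [ltRHS]den_part_ge1//.
- rewrite lte_fin in qr; rewrite den_part_ge1; last by rewrite (le_trans q1)// ltW.
  by rewrite ltf_pV2// posrE; lra.
- by rewrite invr_gt0; lra.
Qed.

Lemma den_part_le x y : (1%:E <= x)%E -> (x <= y)%E -> den_part y <= den_part x.
Proof.
move=> x1; rewrite le_eqVlt => /orP[/eqP->//|xy].
by rewrite ltW// den_part_lt.
Qed.

End HomogeneousCoordinates.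

Section Stretch.
Variables (R : realType) (K : fieldExtType rat) (s : {rmorphism K -> R}).
Variables (A : 'M[K]_2).
Hypothesis A0 : nonneg_entries s A.

Local Notation F := (max_norm_image (s (A 0 0)) (s (A 0 1)) (s (A 1 0)) (s (A 1 1))).

(** Dividing (x, 1) by max(x, 1) gives the normalized coordinates, and the entries being
    nonnegative, absolute values change nothing. The point oo is then treated like the others. *)
Lemma stretchE (x : \bar R) : (0%:E <= x)%E ->
  stretch s A x = F (num_part x) (den_part x).
Proof.
rewrite /max_norm_image => x0.
have /andP[n0 _] := num_part_itv x; have /andP[d0 _] := den_part_itv x.
rewrite !ger0_norm ?addr_ge0 ?mulr_ge0//; case: x x0 {n0 d0} => [r||]//=.
  rewrite lee_fin => r0.
  have m0 : 0 < Num.max r 1 by rewrite lt_max ltr01 orbT.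
  have -> : Num.max 0 (Num.min r 1) = r / Num.max r 1.
    have [r1|/ltW r1] := leP r 1; first by rewrite divr1 max_r.
    by rewrite max_r// divff// gt_eqF// (lt_le_trans ltr01).
  by rewrite maxr_pMl ?invr_ge0 ?ltW// !mulrDl !mulrA.
by move=> _; rewrite !mulr1 !mulr0 !addr0.
Qed.

(** On [0, 1] [den_part] is 1 and [num_part] increases; beyond 1 [num_part] is 1 and [den_part]
    decreases. The coefficients are nonnegative. *)
Lemma stretch_le_left (x y : \bar R) : (0%:E <= x)%E -> (x <= y)%E -> (y <= 1%:E)%E ->
  stretch s A x <= stretch s A y.
Proof.
move=> x0 xy y1; rewrite !stretchE//; last exact: le_trans xy.
rewrite /max_norm_image.
have /andP[n0 _] := num_part_itv x; have /andP[n0' _] := num_part_itv y.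
rewrite !den_part_le1//; last exact: le_trans y1.
have := num_part_le xy => nxy.
rewrite !ger0_norm ?addr_ge0 ?mulr_ge0//.
by rewrite ge_max !le_max !lerD2r !ler_wpM2l// orbT.
Qed.

Lemma stretch_le_right (x y : \bar R) : (1%:E <= x)%E -> (x <= y)%E ->
  stretch s A y <= stretch s A x.
Proof.
move=> x1 xy; have x0 : (0%:E <= x)%E by rewrite (le_trans _ x1)// lee_fin.
rewrite !stretchE//; last exact: le_trans xy.
rewrite /max_norm_image.
have /andP[n0 _] := den_part_itv x; have /andP[n0' _] := den_part_itv y.
rewrite !num_part_ge1//; last exact: le_trans xy.
have := den_part_le x1 xy => nxy.
rewrite !ger0_norm ?addr_ge0 ?mulr_ge0//.
by rewrite ge_max !le_max !lerD2l !ler_wpM2l// orbT.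
Qed.

(** This expression agrees with [stretch] on [0, oo] and extends it continuously to all extended
    reals. *)
Lemma homogeneous_stretch_continuous :
  continuous (fun x : \bar R => F (num_part x) (den_part x)).
Proof.
have lin (p q : R) : continuous (fun x : \bar R => `|p * num_part x + q * den_part x|).
  move=> x; apply: cvg_norm; apply: cvgD; apply: cvgMr.
  - exact: num_part_continuous.
  - exact: den_part_continuous.
by move=> x; apply: (@continuous_max R _ _ _ x (lin _ _ x) (lin _ _ x)).
Qed.

Lemma stretch_real (b : K) : 0 <= s b ->
  F (s b) 1 = stretch s A (s b)%:E * Num.max `|s b| 1.
Proof.
move=> b0; rewrite ger0_norm//= divfK; last by rewrite gt_eqF// lt_max ltr01 orbT.
by rewrite /max_norm_image !mulr1 !ger0_norm ?addr_ge0 ?mulr_ge0.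
Qed.

End Stretch.

(** * Comparison of heights through the stretch and its conjugate *)

Section HeightCriterion.
Variables (R : realType) (K : fieldExtType rat) (hK : \dim {:K} = 2%N).
Variables (s : {rmorphism K -> R}) (tau : {rmorphism K -> K}).
Variable htau : exists x, tau x <> x.
Variables (A : 'M[K]_2).
Hypothesis hA : PSL2pm A.
Hypothesis A0 : nonneg_entries s A.

(** The archimedean heights of b and of its image are max(|b|, 1) times [l] and [r] respectively;
    this common factor is divided out. *)
Lemma height_criterion (b : K) : 0 <= s b ->
  let l := Num.max `|s (tau b)| 1 in
  let r := stretch s A (s b)%:E * max_norm_image (s (tau (A 0 0))) (s (tau (A 0 1)))
     (s (tau (A 1 0))) (s (tau (A 1 1))) (s (tau b)) 1 in
  [/\ l < r -> @height R K (affine_pt b) < height R (A *m affine_pt b),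
      r < l -> @height R K (A *m affine_pt b) < height R (affine_pt b)
    & r = l -> @height R K (A *m affine_pt b) = height R (affine_pt b)].
Proof.
move=> b0 l r; have [h1 h2 h3] := height_mul_compare hK s htau hA b.
have m0 : 0 < Num.max `|s b| 1 by rewrite lt_max ltr01 orbT.
have lE : arch_height s tau b 1 = Num.max `|s b| 1 * l.
  by rewrite /arch_height !rmorph1 normr1.
have rE : arch_height s tau (A 0 0 * b + A 0 1) (A 1 0 * b + A 1 1) = Num.max `|s b| 1 * r.
  rewrite /r mulrA [Num.max `|s b| 1 * _]mulrC -stretch_real//.
  by rewrite /arch_height /max_norm_image !mulr1 !rmorphD !rmorphM.
by split=> h; [apply: h1|apply: h2|apply: h3]; rewrite lE rE ?ltr_pM2l// h.
Qed.

End HeightCriterion.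

(** * The partition of the half-line *)

Section StretchPartition.
Variables (R : realType) (K : fieldExtType rat) (hK : \dim {:K} = 2%N).
Variables (s : {rmorphism K -> R}) (tau : {rmorphism K -> K}).
Variable htau : exists x, tau x <> x.
Variables (A : 'M[K]_2).
Hypothesis hA : PSL2pm A.
Hypothesis hpos : positive_mx s A.
Hypothesis A0 : nonneg_entries s A.

Local Notation f := (stretch s A).
Local Notation t := (threshold s tau A).
Local Notation E1 := (Esharp s tau A).
Local Notation E2 := (Enatural s tau A).
Local Notation E3 := (Eflat s tau A).
Local Notation F := (max_norm_image (s (A 0 0)) (s (A 0 1)) (s (A 1 0)) (s (A 1 1))).
Local Notation F' := (max_norm_image (s (tau (A 0 0))) (s (tau (A 0 1)))
  (s (tau (A 1 0))) (s (tau (A 1 1)))).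

Let adm := admissible_entries hA hpos A0.

Let det1 : `|s (tau (A 0 0)) * s (tau (A 1 1)) - s (tau (A 0 1)) * s (tau (A 1 0))| = 1.
Proof. by move: adm => [_ det _ _ _]; exact: conj_det. Qed.

Lemma rel_open_Esharp : rel_open E1.
Proof.
apply/open_subspaceP; exists [set x | t < F (num_part x) (den_part x)].
  apply: (@open_comp _ _ (fun x => F (num_part x) (den_part x)) [set r | t < r]).
    by move=> x _; exact: homogeneous_stretch_continuous.
  exact: open_gt.
apply/seteqP; split=> x [].
- by move=> h x0; split=> //; split=> //; rewrite (stretchE A0).
- by move=> [x0 h] _; split=> //=; rewrite -stretchE.
Qed.

(** The stretch grows towards 1 from both sides, so at an intermediate point it is at least its
    value at the endpoint farther out on the same side of 1. *)
Lemma interval_Esharp : interval_set E1.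
Proof.
apply: interval_set_convex => x y z [x0 tx] [z0 tz] xy yz; split.
  exact: le_trans xy.
have [y1|/ltW y1] := leP y 1%:E.
- by rewrite (lt_le_trans tx)// stretch_le_left.
- by rewrite (lt_le_trans tz)// stretch_le_right.
Qed.

Lemma Esharp1 : E1 = set0 \/ E1 1%:E.
Proof.
have [->|/set0P[x [x0 tx]]] := eqVneq E1 set0; [by left|right].
split; first by rewrite /pospart /= lee_fin.
have [x1|/ltW x1] := leP x 1%:E.
- by rewrite (lt_le_trans tx)// stretch_le_left.
- by rewrite (lt_le_trans tx)// stretch_le_right.
Qed.

Lemma level_left (x y : \bar R) : E2 x -> E2 y -> (x < y)%E -> (y <= 1%:E)%E ->
  level_structure s tau (A 0 0) (A 0 1) (A 1 0) (A 1 1).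
Proof.
move=> [x0 ex] [y0 ey] xy y1.
have x1 : (x <= 1%:E)%E by rewrite (le_trans _ y1)// ltW.
move: ex ey; rewrite !stretchE// !den_part_le1//.
case: x x0 xy x1 => [x||] // x0; case: y y0 y1 => [y||] // y0 y1 xy x1.
rewrite /pospart /= !lee_fin in x0 y0 y1 x1; rewrite lte_fin in xy.
by rewrite !num_part_le1 ?x0 ?y0//; exact: level_segment.
Qed.

(** From 1 on, the coordinates are [1 : [den_part]]. After the exchange of columns [den_part] is the
    variable; it reverses the order, so the segment starts at y. *)
Lemma level_right (x y : \bar R) : E2 x -> E2 y -> (x < y)%E -> (1%:E <= x)%E ->
  level_structure s tau (A 0 1) (A 0 0) (A 1 1) (A 1 0).
Proof.
move=> [x0 ex] [y0 ey] xy x1.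
have y1 : (1%:E <= y)%E by rewrite (le_trans x1)// ltW.
move: ex ey; rewrite !stretchE// !num_part_ge1// => ex ey.
apply: (level_segment hK htau (admissible_swap_cols adm) _ (den_part_lt x1 xy)).
- by case/andP: (den_part_itv y).
- by rewrite /conj_norm row_sum_norm_swap_cols max_norm_image_swap_cols.
- by rewrite /conj_norm row_sum_norm_swap_cols max_norm_image_swap_cols.
Qed.

(** The first clause of [level_structure] gives the value t on all of [0, 1]. Past 1, [den_part]
    drops below 1, where the second clause excludes the value t. *)
Lemma Enatural_left : level_structure s tau (A 0 0) (A 0 1) (A 1 0) (A 1 1) ->
  E2 = [set` `[0%:E, 1%:E]].
Proof.
move=> [hx hk _]; apply/seteqP; split=> x; rewrite /= in_itv /=.
- move=> [x0 ex]; rewrite [(0 <= x)%E]x0 leNgt; apply/negP => x1.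
  have x1' := ltW x1.
  move: ex; rewrite stretchE// num_part_ge1// => /hk -/(_ (den_part_itv x)) e.
  by have := den_part_lt (lexx 1%:E) x1; rewrite e den_part_le1// ltxx.
- move=> /andP[x0 x1]; split=> //; rewrite stretchE// den_part_le1//.
  by apply: hx; exact: num_part_itv.
Qed.

Lemma Enatural_right : level_structure s tau (A 0 1) (A 0 0) (A 1 1) (A 1 0) ->
  E2 = [set` `[1%:E, +oo%E]].
Proof.
move=> [hx hk _]; apply/seteqP; split=> x; rewrite /= in_itv /=.
- move=> [x0 ex]; rewrite leey andbT leNgt; apply/negP => x1.
  have x1' := ltW x1.
  move: ex; rewrite stretchE// den_part_le1// -max_norm_image_swap_cols => e.
  have := hk _ (num_part_itv x); rewrite /conj_norm row_sum_norm_swap_cols.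
  move=> /(_ e); case: x x0 x1 {e x1'} => [x||]// x0; rewrite lte_fin => x1.
  rewrite /pospart /= lee_fin in x0.
  by rewrite num_part_le1 ?x0 1?ltW// => e; move: x1; rewrite e ltxx.
- move=> /andP[x1 _]; have x0 : (0 <= x)%E by rewrite (le_trans _ x1)// lee_fin.
  split=> //; rewrite stretchE// num_part_ge1// -max_norm_image_swap_cols.
  rewrite hx; last exact: den_part_itv.
  by rewrite /conj_norm row_sum_norm_swap_cols.
Qed.

(** Without a level segment, each side of 1 carries at most one point of the level set. *)
Lemma Enatural_cases :
  (exists x y, E2 `<=` [set x; y]) \/
  level_structure s tau (A 0 0) (A 0 1) (A 1 0) (A 1 1) \/
  level_structure s tau (A 0 1) (A 0 0) (A 1 1) (A 1 0).
Proof.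
have [[x [y [Ex Ey xy y1]]]|nl] :=
    pselect (exists x y, [/\ E2 x, E2 y, (x < y)%E & (y <= 1%:E)%E]).
  by right; left; exact: level_left xy y1.
have [[x [y [Ex Ey xy x1]]]|nr] :=
    pselect (exists x y, [/\ E2 x, E2 y, (x < y)%E & (1%:E <= x)%E]).
  by right; right; exact: level_right xy x1.
(* The point of the level set on each side, or the default 0 if there is none. *)
left; pose x := xget 0%:E [set x | E2 x /\ (x <= 1%:E)%E].
pose y := xget 0%:E [set y | E2 y /\ (1%:E <= y)%E].
exists x, y => z Ez; have [z1|/ltW z1] := leP z 1%:E; [left|right].
- have [Ex x1] : [set x | E2 x /\ (x <= 1%:E)%E] x by apply: xgetPex; exists z.
  have [zx|xz|//] := ltgtP z x; exfalso; apply: nl; first by exists z, x.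
  by exists x, z.
- have [Ey y1] : [set y | E2 y /\ (1%:E <= y)%E] y by apply: xgetPex; exists z.
  have [zy|yz|//] := ltgtP z y; exfalso; apply: nr; first by exists z, y.
  by exists y, z.
Qed.

(** * Growth and decrease of heights on the pieces of the partition *)

Lemma threshold_conj_ge (y : R) : Num.max `|y| 1 <= t * F' y 1.
Proof. by have := max_norm_le_image y 1 det1; rewrite normr1. Qed.

Lemma conj_image_gt0 (y : R) : 0 < F' y 1.
Proof.
rewrite lt0r max_norm_image_ge0 andbT; apply/eqP => e.
by have := threshold_conj_ge y; rewrite e mulr0 ge_max ler10 andbF.
Qed.

Lemma height_Esharp (b : K) : E1 (s b)%:E ->
  @height R K (affine_pt b) < height R (A *m affine_pt b).
Proof.
move=> [b0 tb]; have sb0 : 0 <= s b by rewrite -lee_fin.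
have [h _ _] := height_criterion hK htau hA A0 sb0; apply: h.
by rewrite (le_lt_trans (threshold_conj_ge _))// ltr_pM2r// conj_image_gt0.
Qed.

(** By continuity f = t at a boundary point, so only equality in [threshold_conj_ge] must be
    excluded. It would make the coordinates X, Y of the image agree up to sign after conjugation,
    hence before it; both are positive, so X = Y and the image is 1. *)
Lemma height_boundary (b : K) : strictly_positive_mx s A -> rel_boundary E1 (s b)%:E ->
  ~ same_point (A *m affine_pt b) (affine_pt 1) ->
  @height R K (affine_pt b) < height R (A *m affine_pt b).
Proof.
move=> [B BA Bpos] bd nsame.
have Apos i j : 0 < s (A i j).
  have := Bpos i j; case: BA => -> //; rewrite mxE rmorphN oppr_gt0 ltNge.
  by have := A0 i j => ->.
have A'neq i j : s (tau (A i j)) != 0.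
  by rewrite !fmorph_eq0 -(fmorph_eq0 s) gt_eqF.
have [|b0 cl1 cl2] := rel_boundary_closure _ bd; first by move=> x [].
have sb0 : 0 <= s b by rewrite -lee_fin.
have fc := homogeneous_stretch_continuous (s := s) (A := A).
have ft : f (s b)%:E = t.
  apply/eqP; rewrite eq_le stretchE//; apply/andP; split.
    (* The upper bound comes from the closure of the complement, where f <= t. *)
    rewrite -lerN2; apply: (closure_ge (g := fun x => - F (num_part x) (den_part x)) _ _ cl2).
      by move=> x; apply: cvgN; exact: fc.
    move=> x [x0 nE]; rewrite lerN2 -stretchE// leNgt; apply/negP => tx.
    by apply: nE.
  apply: (closure_ge fc _ cl1) => x [x0 tx]; by rewrite -stretchE// ltW.
have [h _ _] := height_criterion hK htau hA A0 sb0; apply: h; rewrite ft.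
rewrite lt_neqAle threshold_conj_ge andbT; apply/eqP => e.
have := @norm_eq_max_image _ _ _ _ _ (s (tau b)) 1 det1
  (A'neq _ _) (A'neq _ _) (A'neq _ _) (A'neq _ _).
rewrite normr1 => /(_ e)/eqP.
rewrite !mulr1 -!rmorphM -!rmorphD eqr_norm2 -!rmorphN !fmorph_eq.
set X := _ + _; set Y := _ + _.
have X0 : 0 < s X by rewrite rmorphD rmorphM ltr_wpDl// mulr_ge0.
have Y0 : 0 < s Y by rewrite rmorphD rmorphM ltr_wpDl// mulr_ge0.
move=> /orP[/eqP XY|/eqP XY]; last by move: X0; rewrite XY rmorphN oppr_gt0 ltNge ltW.
apply: nsame; exists X; first by rewrite -(fmorph_eq0 s) gt_eqF.
apply/matrixP => i j; rewrite ord1 mulmx_col2 !mxE /=.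
have [->|i0] := eqVneq i 0; first by rewrite !mulr1.
have -> : i = 1 by apply/val_inj; case: i i0 => -[|[|]].
by rewrite !mulr1 -/Y XY.
Qed.

(** Weak approximation puts beta near the given point and its conjugate where |z| <= 1 and t g = 1;
    there the criterion holds with equality. *)
Lemma dense_left : level_structure s tau (A 0 0) (A 0 1) (A 1 0) (A 1 1) ->
  rel_dense ((fun b : K => (s b)%:E) @` [set b | E2 (s b)%:E /\
    @height R K (A *m affine_pt b) = height R (affine_pt b)]) E2.
Proof.
move=> lev; have E2E := Enatural_left lev; have [_ _ [p [q [pq hpq]]]] := lev.
apply: rel_dense_near; first by move=> _ [b [? _] <-].
  by move=> x [].
move=> x W E2x Wx.
have /andP[x0 x1] : (0%:E <= x <= 1%:E)%E by move: E2x; rewrite E2E /= in_itv.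
have [|u [v [uv u0 v1 hW]]] := near_interval (lexx _) x0 x1 _ Wx.
  by rewrite lte_fin.
have [b [/andP[ub bv] /hpq[b1 e]]] := weak_approximation hK s htau uv pq.
exists (s b)%:E; last by apply: hW; rewrite ub.
have sb0 : 0 <= s b by rewrite lee_fin in u0; lra.
have sb1 : s b <= 1 by rewrite lee_fin in v1; lra.
have Eb : E2 (s b)%:E by rewrite E2E /= in_itv /= !lee_fin sb0.
exists b => //; split=> //.
have [_ _ h] := height_criterion hK htau hA A0 sb0; apply: h.
by have [_ ->] := Eb; rewrite max_r.
Qed.

(** The substitution beta = 1 / c: weak approximation is applied to c, with the conjugate interval
    of the matrix with exchanged columns. *)
Lemma dense_right : level_structure s tau (A 0 1) (A 0 0) (A 1 1) (A 1 0) ->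
  rel_dense ((fun b : K => (s b)%:E) @` [set b | E2 (s b)%:E /\
    @height R K (A *m affine_pt b) = height R (affine_pt b)]) E2.
Proof.
move=> lev; have E2E := Enatural_right lev; have [_ _ [p [q [pq hpq]]]] := lev.
apply: rel_dense_near; first by move=> _ [b [? _] <-].
  by move=> x [].
move=> x W E2x Wx.
have /andP[x1 x2] : (1%:E <= x <= +oo)%E by move: E2x; rewrite E2E /= in_itv.
have [||u [v [uv u1 _ hW]]] := @near_interval R 1%:E x +oo%E W _ x1 x2 _ Wx.
- by rewrite lee_fin.
- by rewrite ltey.
rewrite lee_fin in u1.
have u0 : 0 < u by lra.
have v0 : 0 < v by lra.
have vu : v^-1 < u^-1 by rewrite ltf_pV2.
have [c [/andP[vc cu] /hpq[c1 e]]] := weak_approximation hK s htau vu pq.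
have c0 : 0 < s c by rewrite (lt_trans _ vc)// invr_gt0.
have ub : u < s c^-1 by rewrite fmorphV invf_pgt ?posrE.
have bv : s c^-1 < v by rewrite fmorphV invf_plt ?posrE.
exists (s c^-1)%:E; last by apply: hW; rewrite ub.
have sb0 : 0 <= s c^-1 by lra.
have Eb : E2 (s c^-1)%:E by rewrite E2E /= in_itv /= lee_fin leey andbT; lra.
exists c^-1 => //; split=> //.
have [_ _ h] := height_criterion hK htau hA A0 sb0; apply: h.
have [_ ->] := Eb; rewrite !fmorphV; set z := s (tau c) in c1 e *.
have z0 : z != 0 by rewrite !fmorph_eq0 -(fmorph_eq0 s) gt_eqF.
have z0' : 0 < `|z| by rewrite normr_gt0.
(* As |z| <= 1, the maximum of |1 / z| and 1 is 1 / |z|; both sides are then multiplied by |z|. *)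
rewrite normfV max_l; last by rewrite invf_ge1.
apply: (mulIf (lt0r_neq0 z0')); rewrite mulVf ?lt0r_neq0// -[RHS]e -mulrA.
rewrite /conj_norm row_sum_norm_swap_cols; congr (_ * _).
rewrite max_norm_image_swap_cols /max_norm_image maxr_pMl// -!normrM.
by congr Num.max; congr (`|_|); field.
Qed.

(** With f <= M < t on an interval, [contracting_interval] for M supplies the conjugates, and weak
    approximation joins the two conditions. *)
Lemma dense_Eflat :
  rel_dense ((fun b : K => (s b)%:E) @` [set b | E3 (s b)%:E /\
    @height R K (A *m affine_pt b) < height R (affine_pt b)]) E3.
Proof.
apply: rel_dense_near; first by move=> _ [b [? _] <-].
  by move=> x [].
move=> x W [x0 xt] Wx.
have Wt : nbhs x (W `&` [set y | F (num_part y) (den_part y) < t]).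
  have lt : F (num_part x) (den_part x) < t by rewrite -stretchE.
  apply: filterI => //.
  exact: (homogeneous_stretch_continuous (s := s) (A := A) (lt_nbhsl lt)).
have [|u [v [uv u0 _ hW]]] := near_interval (lexx _) x0 (leey x) _ Wt.
  by rewrite ltey.
rewrite lee_fin in u0.
(* Monotonicity gives the uniform bound: on a piece lying on one side of 1, f is at most its value
   at the end nearer to 1, which is chosen strictly between u and v. *)
have [u' [v' [M [u'v' uu' v'v hM Mt]]]] : exists u' v' M,
    [/\ u' < v', u <= u', v' <= v, forall r, u' < r < v' -> f r%:E <= M & M < t].
  have midt r : u < r < v -> f r%:E < t.
    move=> uvr; have [_ h] := hW _ uvr; rewrite stretchE//.
    by rewrite lee_fin; lra.
  have [u1|u1] := ltP u 1.
  - have [m [um mv m1]] : exists m, [/\ u < m, m < v & m <= 1].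
      have [v1|/ltW v1] := leP v 1; first by exists ((u + v) / 2); split; lra.
      by exists ((u + 1) / 2); split; lra.
    exists u, m, (f m%:E); split=> //; [exact: ltW| |by apply: midt; rewrite um].
    move=> r /andP[ur rm]; apply: stretch_le_left => //; rewrite lee_fin//; lra.
  - exists ((u + v) / 2), v, (f ((u + v) / 2)%:E); split=> //; [lra|lra| |].
    + move=> r /andP[ur rm]; apply: stretch_le_right => //; rewrite lee_fin; lra.
    + by apply: midt; apply/andP; split; lra.
have [p [q [pq hpq]]] := contracting_interval det1 Mt.
have [b [/andP[ub bv] /hpq hb]] := weak_approximation hK s htau u'v' pq.
have uvb : u < s b < v by apply/andP; split; lra.
have sb0 : 0 <= s b by lra.
have sbM : f (s b)%:E <= M by apply: hM; rewrite ub.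
exists (s b)%:E; last by have [] := hW _ uvb.
exists b => //; split; first by split; [rewrite /pospart /= lee_fin|exact: le_lt_trans Mt].
have [_ h _] := height_criterion hK htau hA A0 sb0; apply: h.
by rewrite (le_lt_trans _ hb)// ler_wpM2r// max_norm_image_ge0.
Qed.

End StretchPartition.

Theorem theorem4p3 (R : realType) (K : fieldExtType rat)
    (hK : \dim {:K} = 2%N) (s : {rmorphism K -> R})
    (tau : {rmorphism K -> K}) (htau : exists x, tau x <> x)
    (A : 'M[K]_2) (hA : PSL2pm A) (hpos : positive_mx s A)
    (hA0 : nonneg_entries s A) :
  let f := stretch s A in
  let E1 := Esharp s tau A in
  let E2 := Enatural s tau A in
  let E3 := Eflat s tau A in
  let H := @height R K in
  let real := fun b : K => (s b)%:E in
  ((forall x y : \bar R, (0%:E <= x)%E -> (x <= y)%E -> (y <= 1%:E)%E ->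
      f x <= f y) /\
   (forall x y : \bar R, (1%:E <= x)%E -> (x <= y)%E -> f y <= f x)) /\
  (E1 = set0 \/ [/\ rel_open E1, interval_set E1 & E1 1%:E]) /\
  ((exists x y, E2 `<=` [set x; y]) \/ E2 = [set` `[0%:E, 1%:E]] \/
   E2 = [set` `[1%:E, +oo%E]]) /\
  ((forall b : K, E1 (real b) -> H (affine_pt b) < H (A *m affine_pt b)) /\
   (strictly_positive_mx s A ->
    forall b : K, rel_boundary E1 (real b) ->
      ~ same_point (A *m affine_pt b) (affine_pt 1) ->
      H (affine_pt b) < H (A *m affine_pt b))) /\
  (proper_interval E2 ->
   rel_dense
     (real @` [set b | E2 (real b) /\ H (A *m affine_pt b) = H (affine_pt b)])
     E2) /\
  rel_dense
    (real @` [set b | E3 (real b) /\ H (A *m affine_pt b) < H (affine_pt b)])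
    E3.
Proof.
move=> f E1 E2 E3 H real.
split; first by split; [exact: stretch_le_left|exact: stretch_le_right].
split.
  have [E10|E11] := Esharp1 tau hA0; [by left|right].
  by split=> //; [exact: rel_open_Esharp|exact: interval_Esharp].
split.
  have [h|[h|h]] := Enatural_cases hK htau hA hpos hA0; [by left|right; left|right; right].
    exact: Enatural_left.
  exact: Enatural_right.
split.
  by split=> [b|spos b]; [exact: height_Esharp|exact: height_boundary].
split; last exact: dense_Eflat.
move=> pE2; have [[x [y h]]|[h|h]] := Enatural_cases hK htau hA hpos hA0.
- by exfalso; apply: proper_interval_not_le2 pE2 h => z [].
- exact: dense_left.
- exact: dense_right.
Qed.
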